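(* For every integer $n>3$ there exists an $n$-dimensional point lattice $L\subset\mathbb{R}^n$ whose Delaunay tiling contains a Delaunay simplex of relative volume $n-3$. Equivalently, for every integer $n>3$ there is a positive definite quadratic form $f$ on $\mathbb{R}^n$ such that $\mathbb{Z}^n$ has, with respect to $f$, a Delaunay cell that is an $n$-dimensional simplex of relative volume $n-3$.
   Context: A point lattice in $\mathbb{R}^n$ is the set of integer combinations of $n$ linearly independent vectors. Let $L$ be a lattice in $\mathbb{R}^n$ and $f$ a positive definite quadratic form on $\mathbb{R}^n$ (with $f=\sum_i x_i^2$ when no form is mentioned). An empty ellipsoid for $(L,f)$ is an ellipsoid $E=\{x: f(x-c)=r\}$ ($c\in\mathbb{R}^n$, $r>0$) such that no point of $L$ lies strictly inside, i.e. $f(x-c)\ge r$ for all $x\in L$. A Delaunay cell of $L$ with respect to $f$ is an $n$-dimensional polytope $P$ that is the convex hull of all the points of $L$ lying on some empty ellipsoid $E$; the vertices of $P$ are then exactly the points of $L\cap E$. The Delaunay cells form a face-to-face tiling of $\mathbb{R}^n$, the Delaunay tiling. A Delaunay simplex is a Delaunay cell that is a simplex. Lattices with the standard form $\sum_i x_i^2$ correspond, up to isometry and choice of basis, to positive definite forms on $\mathbb{Z}^n$. The relative volume of an $n$-dimensional simplex with vertices $v_0,\dots,v_n\in L$ is its volume divided by the volume of a fundamental simplex of $L$, i.e. the index in $L$ of the sublattice generated by $v_1-v_0,\dots,v_n-v_0$ (for $L=\mathbb{Z}^n$ this is $|\det(v_1-v_0,\dots,v_n-v_0)|$). *)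

(* Defs.v *)
From HB Require Import structures.
From mathcomp Require Import all_boot all_order all_algebra.
From mathcomp Require Import all_classical all_reals all_analysis.

Set Implicit Arguments.
Unset Strict Implicit.
Unset Printing Implicit Defensive.

Import Order.TTheory GRing.Theory Num.Theory.

Local Open Scope classical_set_scope.
Local Open Scope ring_scope.

Section Definitions.
Variables (R : realType) (n : nat).
Implicit Types (L E P S : set 'rV[R]_n) (f : 'rV[R]_n -> R).

Definition int_points : set 'rV[R]_n := range (map_mx intr : 'rV[int]_n -> _).

(* The integer combinations of the rows of B. *)
Definition int_span (B : 'M[R]_n) : set 'rV[R]_n :=
  [set z *m B | z in int_points].

Definition point_lattice L : Prop :=
  exists2 B : 'M[R]_n, row_free B & L = int_span B.

Definition quadratic_form f : Prop :=
  exists2 A : 'M[R]_n, A^T = A & forall x, f x = (x *m A *m x^T) 0 0.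

Definition posdef_quadratic_form f : Prop :=
  quadratic_form f /\ forall x, x != 0 -> 0 < f x.

Definition standard_form (x : 'rV[R]_n) : R := \sum_i x 0 i ^+ 2.

Definition ellipsoid f (c : 'rV[R]_n) (r : R) : set 'rV[R]_n :=
  [set x | f (x - c) = r].

Definition empty_ellipsoid f L E : Prop :=
  exists c r, [/\ 0 < r, E = ellipsoid f c r & forall x, L x -> r <= f (x - c)].

Definition convex_hull S : set 'rV[R]_n := smallest (@convex_set R _) S.

(* Row i is v_{i+1} - v_0. *)
Definition edge_mx (v : 'I_n.+1 -> 'rV[R]_n) : 'M[R]_n :=
  \matrix_(i < n) (v (lift ord0 i) - v ord0).

Definition affinely_independent (v : 'I_n.+1 -> 'rV[R]_n) : Prop :=
  row_free (edge_mx v).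

Definition polytope P : Prop :=
  exists2 S : set 'rV[R]_n, finite_set S & P = convex_hull S.

(* P has dimension n iff it contains n + 1 affinely independent points. *)
Definition full_dimensional P : Prop :=
  exists2 v : 'I_n.+1 -> 'rV[R]_n, affinely_independent v & forall i, P (v i).

Definition simplex_with_vertices P (v : 'I_n.+1 -> 'rV[R]_n) : Prop :=
  affinely_independent v /\ P = convex_hull (range v).

Definition delaunay_cell f L P : Prop :=
  [/\ polytope P, full_dimensional P &
      exists2 E, empty_ellipsoid f L E & P = convex_hull (L `&` E)].

Definition delaunay_tiling f L : set (set 'rV[R]_n) :=
  [set P | delaunay_cell f L P].

Definition cosets L (M : set 'rV[R]_n) : set (set 'rV[R]_n) :=
  [set [set x + y | y in M] | x in L].

Definition has_index L (M : set 'rV[R]_n) (m : nat) : Prop :=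
  M `<=` L /\ (cosets L M #= `I_m)%card.

(* The relative volume of the simplex with vertices v, as the index in L of
   the sublattice generated by the differences v_i - v_0. *)
Definition has_relative_volume L (v : 'I_n.+1 -> 'rV[R]_n) (m : nat) : Prop :=
  (forall i, L (v i)) /\ has_index L (int_span (edge_mx v)) m.

Definition delaunay_simplex_of_relative_volume f L (m : nat) : Prop :=
  exists P v, [/\ delaunay_tiling f L P, simplex_with_vertices P v &
                  has_relative_volume L v m].

End Definitions.

Arguments int_points : clear implicits.
Arguments standard_form : clear implicits.

(* Main.v *)
Require Import Defs.
From HB Require Import structures.
From mathcomp Require Import all_boot all_order all_algebra.
From mathcomp Require Import all_classical all_reals all_analysis.
From mathcomp Require Import zify ring lra.

Set Implicit Arguments.
Unset Strict Implicit.
Unset Printing Implicit Defensive.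

Import Order.TTheory GRing.Theory Num.Theory.

Local Open Scope classical_set_scope.
Local Open Scope ring_scope.

(** Put m = n - 3 >= 1.  Keep the simplex simple and move the complexity into
    the lattice: the simplex has vertices 0, e_1, ..., e_n, and the lattice is
    Z^n + Z p with p = (1, ..., 1, -1) / m, in which Z^n, the lattice spanned
    by the edges, has index m.  In barycentric coordinates
    (x_0, x_1, ..., x_n), where x_0 = 1 - (x_1 + ... + x_n), the point p has
    m + 2 = n - 1 light coordinates equal to 1/m and two heavy ones, at the
    vertices 0 and e_n, equal to -1/m.

    The form is diagonal in barycentric coordinates: the displacement d has
    squared length \sum_i a_i d_i^2, where d_0 = -(d_1 + ... + d_n).  It is
    therefore positive definite for all positive weights a_i.  The quadratic
    function \sum_i a_i (x_i^2 - x_i) (the gauge) vanishes at all the vertices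
    and differs from the form only by affine terms.  So it is the power of x
    with respect to the ellipsoid through the vertices
    ([simplex_circumcenter]), and the simplex is a Delaunay cell exactly when
    the gauge is positive at all the other lattice points.

    At the points of Z^n each term y^2 - y is nonnegative, and all of them
    vanish only at the vertices.  At a point of the coset t p + Z^n, 0 < t < m,
    write tau = t/m.  The light coordinates lie in tau + Z, the heavy ones in
    -tau + Z, and the coordinates sum to 1.  The gauge is a separable convex
    function on these points.  With a suitable Lagrange multiplier for the sum
    condition each coordinate is bounded below on its own, and what remains is
    an inequality in m, t and tau.  For m >= 2 it holds for all t if the ratio
    light weight / heavy weight lies strictly between
    2 / m = 2 (m + 1) / (m^2 + m) and
    2 (m + 1) / ((m + 2) (m - 1)) = 2 (m + 1) / (m^2 + m - 2),
    which leaves room for the weights 2 (m + 1) and m^2 + m - 1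
    ([heavy_pair_bound], [simplex_gauge_glued_lattice]).

    Both forms of the theorem are linear images of this picture: a matrix H
    that turns the weighted form into the standard one
    ([simplex_form_gram_root]) gives the lattice for the standard form, and the
    inverse of a basis matrix of the lattice carries it to Z^n
    ([delaunay_simplex_of_gauge] treats both at once). *)

(** * Integer estimates *)

(** The form in which integrality enters every estimate: a quadratic with
    roots at distance at most 1 from each other, one of them an integer, is
    nonnegative on the integers. *)
Lemma int_mul_add_ge0 (R : realType) (y b : R) :
  y \is a Num.int -> -1 <= b <= 1 -> 0 <= y * (y + b).
Proof.
move=> /intrP[z ->] /andP[b1 b2].
have [z0|z0|->] := ltrgt0P z; last by rewrite mul0r.
- have : (1 : R) <= z%:~R by rewrite -[1]/(1%:~R) ler_int; lia.
  nra.
- have : z%:~R <= (-1 : R) by rewrite -[-1]/((-1)%:~R) ler_int; lia.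
  nra.
Qed.

(** In the coset of t p, the light coordinates u satisfy
    u^2 - u >= (1 - tau) (tau - 2 u), with equality at u = tau and
    u = tau - 1.  Once the light coordinates are bounded in this way, only
    their sum 1 - w - w' is left, and the last summand below is what they
    contribute.  The expression that remains is separately quadratic in the
    heavy coordinates w and w', with the multiplier C l = 2 A (1 - tau).
    Depending on l, its minimum on -tau + Z lies at 1 - tau or at -tau; the
    weights A and C make both minima positive. *)
Lemma heavy_pair_bound (R : realType) (m t : nat) (w w' : R) :
  let tau := t%:R / m%:R in
  let A := 2 * (m%:R + 1) in
  let C := m%:R ^+ 2 + m%:R - 1 in
  (0 < t < m)%N -> w + tau \is a Num.int -> w' + tau \is a Num.int ->
  0 < C * (w ^+ 2 - w) + C * (w' ^+ 2 - w') +
      A * (1 - tau) * ((m%:R + 2) * tau - 2 * (1 - w - w')).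
Proof.
move=> tau A C /andP[t0 tm] hw hw'.
have m0 : (0 : R) < m%:R by rewrite ltr0n (leq_ltn_trans _ tm).
have t1 : (1 : R) <= t%:R by rewrite ler1n.
have m2 : (2 : R) <= m%:R by rewrite ler_nat (leq_ltn_trans t0 tm).
have tauE : m%:R * tau = t%:R by rewrite /tau mulrC divfK ?gt_eqF.
have tau_gt0 : 0 < tau by rewrite divr_gt0 // (lt_le_trans _ t1).
have tau_lt1 : tau < 1 by rewrite ltr_pdivrMr // mul1r ltr_nat.
have C0 : 0 < C by rewrite /C; nra.
have CE : C * tau = (m%:R + 1) * t%:R - tau.
  by rewrite -tauE /C; ring.
pose l := 2 * A * (1 - tau) / C.
have lE : C * l = 2 * A * (1 - tau) by rewrite /l mulrC divfK ?gt_eqF.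
have l0 : 0 <= l by rewrite /l divr_ge0 ?(ltW C0) // /A; nra.
have key b y : 0 <= y * (y + b) -> 0 <= C * (y * (y + b)).
  by move=> ?; rewrite mulr_ge0 ?(ltW C0).
clearbody l; clearbody tau.
have [lt|lt] := leP l (2 * tau).
  (* Here the minimum is attained at w = w' = 1 - tau. *)
- have H y : y + tau \is a Num.int ->
     0 <= C * ((y + tau - 1) * ((y + tau - 1) + (1 - 2 * tau + l))).
    move=> hy; apply: key; apply: int_mul_add_ge0; first by rewrite rpredB ?rpred1.
    by apply/andP; split; lra.
  have := H _ hw; have := H _ hw'.
  set X := C * _; set Y := C * _ => X0 Y0.
  suff : 0 < (1 - tau) * (4 * m%:R + 4 - tau * (4 * m%:R + 2)).
    suff -> : C * (w ^+ 2 - w) + C * (w' ^+ 2 - w') +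
      A * (1 - tau) * ((m%:R + 2) * tau - 2 * (1 - w - w')) =
      X + Y + (1 - tau) * (4 * m%:R + 4 - tau * (4 * m%:R + 2)) by lra.
    have -> : X + Y = C * ((w + tau - 1) * (w + tau - 1 + (1 - 2 * tau)) +
       (w' + tau - 1) * (w' + tau - 1 + (1 - 2 * tau))) +
       (C * l) * (w + tau - 1 + w' + tau - 1) by rewrite /X /Y; ring.
    by rewrite lE /A /C; ring.
  by apply: mulr_gt0; nra.
  (* Here it is attained at w = w' = - tau, and the bound relies on t >= 1. *)
- have l2 : l <= 2 + 2 * tau.
    rewrite -(ler_pM2l C0) lE (_ : C * _ = 2 * C + 2 * (C * tau)); last by ring.
    rewrite CE /A /C.
    nra.
  have H y : y + tau \is a Num.int ->
     0 <= C * ((y + tau) * ((y + tau) + (l - 2 * tau - 1))).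
    move=> hy; apply: key; apply: int_mul_add_ge0 => //.
    by apply/andP; split; lra.
  have := H _ hw; have := H _ hw'.
  set X := C * _; set Y := C * _ => X0 Y0.
  suff : 0 < 2 * ((m%:R + 1) * (2 * (t%:R - 1) + 2 * tau ^+ 2) - tau - tau ^+ 2).
    suff -> : C * (w ^+ 2 - w) + C * (w' ^+ 2 - w') +
      A * (1 - tau) * ((m%:R + 2) * tau - 2 * (1 - w - w')) =
      X + Y + 2 * ((m%:R + 1) * (2 * (t%:R - 1) + 2 * tau ^+ 2) - tau - tau ^+ 2) by lra.
    have -> : X + Y = C * ((w + tau) * (w + tau - 2 * tau - 1) +
       (w' + tau) * (w' + tau - 2 * tau - 1)) +
       (C * l) * (w + tau + w' + tau) by rewrite /X /Y; ring.
    by rewrite lE -tauE /A /C; ring.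
  have : tau <= m%:R * tau * tau by rewrite tauE ler_peMl // ltW.
  have : (0 : R) <= (m%:R + 1) * (t%:R - 1) by rewrite mulr_ge0 ?subr_ge0 // addr_ge0 ?ltW.
  nra.
Qed.

(** * Forms that are diagonal in barycentric coordinates *)

Section Gauge.
Variables (R : realType) (n : nat).
Implicit Types (a : 'I_n -> R) (b : R) (x y : 'rV[R]_n).

Lemma int_pointsP x :
  int_points R n x <-> forall i, x 0 i \is a Num.int.
Proof.
split=> [[z _ <-] i|hx]; first by rewrite mxE intr_int.
exists (map_mx Num.floor x) => //; apply/rowP => i.
by rewrite !mxE; apply/eqP; rewrite -intrEfloor.
Qed.

Lemma int_pointsB x y :
  int_points R n x -> int_points R n y ->
  int_points R n (x - y).
Proof.
move=> /int_pointsP hx /int_pointsP hy; apply/int_pointsP => i.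
by rewrite !mxE rpredB.
Qed.

Lemma int_pointsD x y :
  int_points R n x -> int_points R n y ->
  int_points R n (x + y).
Proof.
move=> /int_pointsP hx /int_pointsP hy; apply/int_pointsP => i.
by rewrite !mxE rpredD.
Qed.

Lemma int_pointsZ (t : int) x :
  int_points R n x -> int_points R n (t%:~R *: x).
Proof.
move=> /int_pointsP hx; apply/int_pointsP => i.
by rewrite !mxE rpredM ?intr_int.
Qed.

Definition coord_sum x := \sum_i x 0 i.

(** The square of the zeroth barycentric coordinate of a displacement x, which
    is - coord_sum x, carries the weight b. *)
Definition simplex_form a b x := \sum_i a i * x 0 i ^+ 2 + b * coord_sum x ^+ 2.

(** The quadratic function with leading part [simplex_form a b] that vanishes
    at 0 and at all e_i.  The last summand is the term y^2 - y of the zeroth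
    barycentric coordinate y = 1 - coord_sum x. *)
Definition simplex_gauge a b x :=
  \sum_i a i * (x 0 i ^+ 2 - x 0 i) + b * (coord_sum x ^+ 2 - coord_sum x).

(** All terms y^2 - y are nonnegative at integers, so a zero of the gauge has
    all its barycentric coordinates, which sum to 1, in {0, 1}. *)
Lemma simplex_gauge_int a b x : (forall i, 0 < a i) -> 0 < b ->
  int_points R n x -> x != 0 -> (forall i, x != delta_mx 0 i) ->
  0 < simplex_gauge a b x.
Proof.
move=> a0 b0 /int_pointsP xint x0 xd.
have sq (y : R) : y \is a Num.int -> 0 <= y ^+ 2 - y.
  move=> hy; have := @int_mul_add_ge0 _ y (-1) hy; rewrite mulrDr mulrN1 -expr2.
  by apply; rewrite lexx /=; lra.
have sum_int : coord_sum x \is a Num.int by apply: rpred_sum => i _; exact: xint.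
have ge1 i : 0 <= a i * (x 0 i ^+ 2 - x 0 i) by rewrite mulr_ge0 ?sq ?ltW.
have ge2 : 0 <= b * (coord_sum x ^+ 2 - coord_sum x) by rewrite mulr_ge0 ?sq ?ltW.
rewrite lt0r addr_ge0 ?sumr_ge0 // andbT; apply/negP.
rewrite paddr_eq0 ?sumr_ge0 // psumr_eq0 //.
case/andP => /allP ai; rewrite mulf_eq0 gt_eqF //= => hs.
have bin (y : R) : y ^+ 2 - y == 0 -> y = 0 \/ y = 1.
  rewrite expr2 -{3}[y]mulr1 -mulrBr mulf_eq0 subr_eq0.
  by case/orP => /eqP; auto.
have xi i : x 0 i = 0 \/ x 0 i = 1.
  by apply: bin; have := ai i (mem_index_enum i); rewrite /= mulf_eq0 gt_eqF.
case/rV0Pn: x0 => j xj0; have xj : x 0 j = 1 by case: (xi j) xj0 => -> //; rewrite eqxx.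
case/negP: (xd j); apply/eqP/rowP => i; rewrite !mxE eqxx /=.
have xge i' : 0 <= x 0 i' by case: (xi i') => ->.
have sE : coord_sum x = 1 + \sum_(i | i != j) x 0 i by rewrite /coord_sum (bigD1 j) //= xj.
have s0 : 0 <= \sum_(i | i != j) x 0 i by rewrite sumr_ge0.
have [ij|ij] := eqVneq i j; first by rewrite ij xj.
have : \sum_(i | i != j) x 0 i == 0.
  by case: (bin _ hs) => h; apply/eqP; lra.
by rewrite psumr_eq0 // => /allP /(_ i (mem_index_enum i)); rewrite ij /= => /eqP.
Qed.

End Gauge.

Section SimplexForm.
Variables (R : realType) (n : nat) (a : 'I_n.+1 -> R) (b : R).
Hypotheses (a_gt0 : forall i, 0 < a i) (b_gt0 : 0 < b).
Implicit Types (x : 'rV[R]_n.+1).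

Let W := \sum_i (a i)^-1.

Let W_gt0 : 0 < W.
Proof.
rewrite /W big_ord_recl ltr_wpDr ?invr_gt0 ?a_gt0 //; apply: sumr_ge0 => i _.
by rewrite invr_ge0 ltW.
Qed.

Lemma simplex_form_posdef x : x != 0 -> 0 < simplex_form a b x.
Proof.
case/rV0Pn => i xi; rewrite /simplex_form.
apply: ltr_wpDr; first by rewrite mulr_ge0 ?sqr_ge0 ?ltW.
rewrite (bigD1 i) //=; apply: ltr_wpDr.
  by apply: sumr_ge0 => j _; rewrite mulr_ge0 ?sqr_ge0 ?ltW.
by rewrite mulr_gt0 // exprn_even_gt0.
Qed.

(** The center must satisfy a_i (2 c_i - 1) = 2 mu for all barycentric
    coordinates, including the zeroth with a_0 = b, so c_i = 1/2 + mu / a_i;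
    the sum condition on the c_i then determines mu. *)
Lemma simplex_circumcenter : exists c r, 0 < r /\
  forall x, simplex_form a b (x - c) = simplex_gauge a b x + r.
Proof.
have Wb : 0 < W + b^-1 by rewrite addr_gt0 ?invr_gt0.
pose mu := (1 - n.+2%:R / 2) / (W + b^-1).
have muE : mu * (W + b^-1) = 1 - n.+2%:R / 2 by rewrite divfK ?gt_eqF.
pose c : 'rV[R]_n.+1 := \row_i (2^-1 + mu / a i).
exists c, (\sum_i a i * c 0 i ^+ 2 + b * (mu / b - 2^-1) ^+ 2); split.
  have ge0 i : 0 <= a i * c 0 i ^+ 2 by rewrite mulr_ge0 ?sqr_ge0 ?ltW.
  (* The squared radius could only vanish if c were 0; mu / b = 1/2 says that
     the zeroth coordinate of c is 1, and then mu > 0 makes all the other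
     coordinates positive. *)
  have [mub|mub] := eqVneq (mu / b) 2^-1.
    have mu0 : 0 < mu by rewrite -(pmulr_lgt0 (x := b^-1)) ?invr_gt0 // mub invr_gt0.
    apply: ltr_wpDr; first by rewrite mulr_ge0 ?sqr_ge0 ?ltW.
    rewrite big_ord_recl; apply: ltr_wpDr; first exact: sumr_ge0.
    by rewrite mulr_gt0 // exprn_gt0 // mxE addr_gt0 ?invr_gt0 // divr_gt0.
  by rewrite ltr_wpDl ?sumr_ge0 // mulr_gt0 // exprn_even_gt0 //= subr_eq0.
move=> x; rewrite /simplex_form /simplex_gauge.
have -> : coord_sum (x - c) = coord_sum x - 2^-1 + mu / b.
  rewrite /coord_sum; under eq_bigr do rewrite !mxE.
  rewrite sumrB big_split /= sumr_const card_ord -mulr_sumr -/W -[_ *+ _]mulr_natl.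
  move: muE; rewrite -addn1 natrD; lra.
have -> : \sum_i a i * (x - c) 0 i ^+ 2 = \sum_i a i * (x 0 i ^+ 2 - x 0 i) -
   2 * mu * coord_sum x + \sum_i a i * c 0 i ^+ 2.
  rewrite /coord_sum mulr_sumr -sumrB -big_split /=; apply: eq_bigr => i _.
  by rewrite !mxE; field; rewrite gt_eqF.
by field; rewrite gt_eqF.
Qed.

(** After rescaling by the square roots of the a_i the Gram matrix is
    I + b v v^T with v_i = a_i^(-1/2), whose square root is I + beta v v^T for
    a root beta of 2 beta + beta^2 |v|^2 = b. *)
Lemma simplex_form_gram_root : exists H : 'M[R]_n.+1,
  forall x, standard_form R n.+1 (x *m H) = simplex_form a b x.
Proof.
pose beta := (Num.sqrt (1 + b * W) - 1) / W.
have betaE : 2 * beta + beta ^+ 2 * W = b.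
  have bW : 0 <= 1 + b * W by rewrite addr_ge0 // mulr_ge0 ?ltW.
  have := sqr_sqrtr bW; rewrite /beta; set s := Num.sqrt _ => sE.
  have -> : 2 * ((s - 1) / W) + ((s - 1) / W) ^+ 2 * W = (s ^+ 2 - 1) / W.
    by field; rewrite gt_eqF.
  by rewrite sE addrC addKr mulfK ?gt_eqF.
exists (diag_mx (\row_i Num.sqrt (a i)) + \matrix_(i, j) (beta / Num.sqrt (a j))).
move=> x; rewrite /standard_form /simplex_form.
have xE j : (x *m (diag_mx (\row_i Num.sqrt (a i)) +
    \matrix_(i, j) (beta / Num.sqrt (a j)))) 0 j =
    x 0 j * Num.sqrt (a j) + beta * coord_sum x / Num.sqrt (a j).
  rewrite mulmxDr mul_mx_diag !mxE; congr (_ + _).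
  under eq_bigr do rewrite mxE.
  by rewrite -mulr_suml /coord_sum; ring.
under eq_bigr do rewrite xE.
rewrite -betaE mulrDl addrA.
have -> : \sum_i a i * x 0 i ^+ 2 + 2 * beta * coord_sum x ^+ 2 +
    beta ^+ 2 * W * coord_sum x ^+ 2 =
  \sum_i (a i * x 0 i ^+ 2 + 2 * beta * coord_sum x * x 0 i +
    (beta * coord_sum x) ^+ 2 / a i).
  by rewrite !big_split /= -!mulr_sumr -/W -/(coord_sum x); ring.
apply: eq_bigr => i _; have s_gt0 : 0 < Num.sqrt (a i) by rewrite sqrtr_gt0.
have := sqr_sqrtr (ltW (a_gt0 i)); move: (Num.sqrt (a i)) s_gt0 => s s_gt0 <-.
by field; rewrite gt_eqF.
Qed.

End SimplexForm.

(** * From the gauge to a Delaunay simplex *)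

Lemma range_ord_recl (n : nat) (T : Type) (v : 'I_n.+1 -> T) :
  range v = v ord0 |` range (fun i : 'I_n => v (lift ord0 i)).
Proof.
apply/seteqP; split=> x /=.
  by case=> i _ <-; case: (unliftP ord0 i) => [j|] ->; [right; exists j|left].
by case=> [->|[j _ <-]]; [exists ord0|exists (lift ord0 j)].
Qed.

Lemma has_index_mulmx (R : realType) (n m : nat) (L M : set 'rV[R]_n) (K : 'M[R]_n) :
  row_free K -> has_index L M m ->
  has_index [set x *m K | x in L] [set x *m K | x in M] m.
Proof.
move=> Kf [ML cLM]; split; first by apply: image_subset.
have Kinj : injective (mulmx^~ K : 'rV[R]_n -> _) by exact: row_free_inj.
have -> : cosets [set x *m K | x in L] [set x *m K | x in M] =
    [set [set x *m K | x in A] | A in cosets L M].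
  have coset_mul x : [set x *m K + y | y in [set y *m K | y in M]] =
      [set y *m K | y in [set x + y | y in M]].
    by rewrite !image_comp; apply: eq_imagel => y _ /=; rewrite mulmxDl.
  rewrite /cosets !image_comp; apply: eq_imagel => x _ /=; exact: coset_mul.
apply: card_eq_trans cLM; apply: inj_card_eq => A B _ _ AB.
apply/seteqP; split=> x xA.
  have : [set x *m K | x in B] (x *m K) by rewrite -AB; exists x.
  by case=> y yB /Kinj <-.
have : [set x *m K | x in A] (x *m K) by rewrite AB; exists x.
by case=> y yB /Kinj <-.
Qed.

(** The matrix K carries the simplex 0, e_1, ..., e_n to the one with vertices
    0 and the rows of K, so that K itself is the edge matrix.  Since K is
    arbitrary, one statement serves both the lattices with the standard form
    and the forms on Z^n. *)
Lemma delaunay_simplex_of_gauge (R : realType) (n m : nat)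
    (a : 'I_n.+1 -> R) (b : R) (L : set 'rV[R]_n.+1)
    (K : 'M[R]_n.+1) (f : 'rV[R]_n.+1 -> R) :
  (forall i, 0 < a i) -> 0 < b ->
  has_index L (int_points R n.+1) m ->
  (forall x, L x -> x != 0 -> (forall i, x != delta_mx 0 i) ->
    0 < simplex_gauge a b x) ->
  row_free K -> (forall x, f (x *m K) = simplex_form a b x) ->
  delaunay_simplex_of_relative_volume f [set x *m K | x in L] m.
Proof.
move=> a0 b0 Lm gauge_gt0 Kf fK.
have [c [r [r0 cE]]] := simplex_circumcenter a0 b0.
pose v (i : 'I_n.+2) := oapp (fun j => row j K) 0 (unlift ord0 i).
have v0 : v ord0 = 0 by rewrite /v unlift_none.
have vS j : v (lift ord0 j) = row j K by rewrite /v liftK.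
have edge : edge_mx v = K.
  by apply/row_matrixP => i; rewrite rowK vS v0 subr0.
have ZL : int_points R n.+1 `<=` L by case: Lm.
have L0 : L 0 by apply: ZL; apply/int_pointsP => i; rewrite mxE rpred0.
have Ld j : L (delta_mx 0 j).
  by apply: ZL; apply/int_pointsP => i; rewrite mxE natr_int.
have gauge0 : simplex_gauge a b 0 = 0.
  by rewrite /simplex_gauge /coord_sum !big1 => *; rewrite ?mxE; ring.
have gauged j : simplex_gauge a b (delta_mx 0 j) = 0.
  have -> : simplex_gauge a b (delta_mx 0 j) = 0 + b * (1 ^+ 2 - 1); last by ring.
  congr (_ + b * (_ ^+ 2 - _)).
  - by rewrite big1 // => i _; rewrite mxE eqxx; case: eqP => _ /=; ring.
  - rewrite /coord_sum (bigD1 j) //= big1 ?mxE ?eqxx ?addr0 // => i /negbTE ij.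
    by rewrite mxE eqxx ij.
  - rewrite /coord_sum (bigD1 j) //= big1 ?mxE ?eqxx ?addr0 // => i /negbTE ij.
    by rewrite mxE eqxx ij.
have fE x : f (x *m K - c *m K) = simplex_gauge a b x + r.
  by rewrite -mulmxBl fK cE.
have Lv i : [set x *m K | x in L] (v i).
  case: (unliftP ord0 i) => [j|] ->; last by exists 0; rewrite ?mul0mx.
  by exists (delta_mx 0 j); rewrite // vS rowE.
have LE : [set x *m K | x in L] `&` ellipsoid f (c *m K) r = range v.
  rewrite range_ord_recl v0; apply/seteqP; split=> y /=.
    case=> -[x Lx <-]; rewrite /ellipsoid /= fE => gx.
    have {}gx : simplex_gauge a b x = 0 by lra.
    have [->|x0] := eqVneq x 0; first by left; rewrite mul0mx.
    right; apply: contrapT => xd; have := gauge_gt0 x Lx x0.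
    rewrite gx ltxx => gx0; suff : false by [].
    by apply: gx0 => i; apply/eqP => xi; apply: xd; exists i; rewrite // vS rowE xi.
  case=> [->|[j _ <-]].
    split; first by exists 0; rewrite ?mul0mx.
    by rewrite /ellipsoid /= -[X in X - _](mul0mx _ K) fE gauge0 add0r.
  split; first exact: Lv.
  by rewrite vS rowE /ellipsoid /= fE gauged add0r.
have vf : affinely_independent v by rewrite /affinely_independent edge.
have Ev : empty_ellipsoid f [set x *m K | x in L] (ellipsoid f (c *m K) r).
  exists (c *m K), r; split=> // _ [x Lx <-]; rewrite fE lerDr.
  have [->|x0] := eqVneq x 0; first by rewrite gauge0.
  have [[i ->]|xd] := pselect (exists i, x = delta_mx 0 i); first by rewrite gauged.
  by apply/ltW/gauge_gt0 => // i; apply/eqP => xi; apply: xd; exists i.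
exists (convex_hull (range v)), v; split=> //.
- split.
  + by exists (range v) => //; exact: finite_image.
  + by exists v => // i A [_ vA]; apply: vA; exists i.
  + by exists (ellipsoid f (c *m K) r); rewrite ?LE.
- by split=> //; rewrite edge; exact: has_index_mulmx.
Qed.

(** * The lattice Z^n + Z p *)

Section GluedLattice.
Variables (R : realType) (m : nat).
Hypothesis m_gt0 : (0 < m)%N.
Local Notation V := 'rV[R]_m.+3.

(** The point p = (1, ..., 1, -1) / m. *)
Definition glue_vector : V := \row_i ((if i == ord_max then -1 else 1) / m%:R).

Definition glued_lattice : set V :=
  [set x | exists t : int, int_points R m.+3 (x - t%:~R *: glue_vector)].

Definition glue_weight (i : 'I_m.+3) : R :=
  if i == ord_max then m%:R ^+ 2 + m%:R - 1 else 2 * (m%:R + 1).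

Let m0 : (0 : R) < m%:R. Proof. by rewrite ltr0n. Qed.

Lemma int_points_glue : int_points R m.+3 (m%:R *: glue_vector).
Proof.
apply/int_pointsP => i; rewrite !mxE mulrC divfK ?lt0r_neq0 //.
by case: ifP => _; rewrite ?rpredN rpred1.
Qed.

Lemma glued_lattice_rep x : glued_lattice x ->
  exists2 t, (t < m)%N & int_points R m.+3 (x - t%:R *: glue_vector).
Proof.
move=> [t ht]; exists `|(t %% m%:Z)%Z|%N; first by rewrite -ltz_nat; lia.
have e : (`|(t %% m%:Z)%Z|%N%:R : R) = (t %% m%:Z)%Z%:~R.
  by rewrite -[LHS]/((Posz _)%:~R) gez0_abs // modz_ge0; lia.
have -> : x - `|(t %% m)%Z|%N%:R *: glue_vector =
   (x - t%:~R *: glue_vector) + (t %/ m%:Z)%Z%:~R *: (m%:R *: glue_vector).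
  rewrite e scalerA -addrA; congr (_ + _).
  have -> : (t%:~R : R) = (t %/ m%:Z)%Z%:~R * m%:R + (t %% m%:Z)%Z%:~R.
    by rewrite {1}(divz_eq t m%:Z) rmorphD rmorphM.
  by rewrite scalerDl opprD addrAC addNr add0r.
by apply: int_pointsD => //; apply: int_pointsZ; exact: int_points_glue.
Qed.

Lemma glue_weight_gt0 i : 0 < glue_weight i.
Proof.
have : (1 : R) <= m%:R by rewrite ler1n.
by rewrite /glue_weight; case: ifP => _; nra.
Qed.

(** Together with the circumscribed ellipsoid this says that no lattice point
    other than the vertices lies in or on it. *)
Lemma simplex_gauge_glued_lattice x :
  glued_lattice x -> x != 0 -> (forall i, x != delta_mx 0 i) ->
  0 < simplex_gauge glue_weight (glue_weight ord_max) x.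
Proof.
move=> /glued_lattice_rep[[|t] tm xt x0 xd].
  apply: simplex_gauge_int => //; [exact: glue_weight_gt0|exact: glue_weight_gt0|].
  by move: xt; rewrite scale0r subr0.
move/int_pointsP: xt => xt.
pose tau : R := t.+1%:R / m%:R.
have tau_lt1 : tau < 1 by rewrite ltr_pdivrMr // mul1r ltr_nat.
have tauE : m%:R * tau = t.+1%:R by rewrite /tau mulrC divfK ?gt_eqF.
have wmax : glue_weight ord_max = m%:R ^+ 2 + m%:R - 1 by rewrite /glue_weight eqxx.
pose u (i : 'I_m.+2) := x 0 (widen_ord (leqnSn _) i).
have nmax (i : 'I_m.+2) : (widen_ord (leqnSn _) i == ord_max) = false.
  by apply/negbTE; rewrite -val_eqE /= neq_ltn ltn_ord.
have uint i : u i - tau \is a Num.int.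
  have := xt (widen_ord (leqnSn _) i); rewrite !mxE nmax mul1r.
  by rewrite -[_ * _^-1]/tau.
set w := x 0 ord_max.
have wint : w + tau \is a Num.int.
  by have := xt ord_max; rewrite !mxE eqxx mulN1r mulrN opprK.
(* The barycentric coordinate at the vertex 0, the second heavy one. *)
pose w' := 1 - coord_sum x.
have sE : coord_sum x = \sum_i u i + w by rewrite /coord_sum big_ord_recr.
have w'int : w' + tau \is a Num.int.
  have -> : w' + tau = 1 - t.+1%:R - (w + tau) - \sum_i (u i - tau).
    rewrite /w' sE sumrB sumr_const card_ord -[tau *+ _]mulr_natl.
    have -> : (m.+2%:R : R) = m%:R + 2 by rewrite -addn2 natrD.
    rewrite -tauE; ring.
  by rewrite !rpredB ?rpred1 ?rpred_nat ?rpred_sum.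
have := @heavy_pair_bound R m t.+1 w w' _ wint w'int.
rewrite -/tau tm => /(_ isT) /lt_le_trans; apply.
clearbody tau.
rewrite /simplex_gauge big_ord_recr /= wmax -/w.
have -> : coord_sum x = 1 - w' by rewrite /w'; ring.
suff : 2 * (m%:R + 1) * (1 - tau) * ((m%:R + 2) * tau - 2 * (1 - w - w')) <=
  \sum_(i < m.+2) glue_weight (widen_ord (leqnSn m.+2) i) * (u i ^+ 2 - u i).
  rewrite /u; lra.
have -> : (m%:R + 2) * tau - 2 * (1 - w - w') = \sum_(i < m.+2) (tau - 2 * u i).
  rewrite sumrB -mulr_sumr sumr_const card_ord -[tau *+ _]mulr_natl /w' sE.
  have -> : (m.+2%:R : R) = m%:R + 2 by rewrite -addn2 natrD.
  ring.
rewrite mulr_sumr; apply: ler_sum => i _; rewrite /glue_weight nmax -mulrA.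
apply: ler_wpM2l; first by move: m0 => ?; lra.
(* This is (u - tau) (u - tau + 1) >= 0, as u - tau is an integer. *)
have := @int_mul_add_ge0 _ (u i - tau) 1 (uint i).
rewrite lexx; lra.
Qed.

End GluedLattice.
Arguments glued_lattice : clear implicits.

Section GluedLatticeIndex.
Variables (R : realType) (m : nat).
Hypothesis m_gt0 : (0 < m)%N.
Local Notation V := 'rV[R]_m.+3.

Let m0 : (m%:R : R) != 0. Proof. by rewrite pnatr_eq0 -lt0n. Qed.

Let glue0 : glue_vector R m 0 ord0 = m%:R^-1.
Proof. by rewrite mxE div1r. Qed.

Let mglue i : m%:R * glue_vector R m 0 i \is a Num.int.
Proof. by move: (int_points_glue R m_gt0) => /int_pointsP/(_ i); rewrite mxE. Qed.

Lemma glue_mul_int (t : int) : int_points R m.+3 (t%:~R *: glue_vector R m) -> (m %| t)%Z.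
Proof.
move=> /int_pointsP/(_ ord0); rewrite mxE glue0 => /intrP[k tk].
apply/dvdzP; exists k; apply: (@intr_inj R).
by rewrite intrM -tk divfK.
Qed.

(** The cosets of Z^n in the lattice are those of t p for t = 0, ..., m - 1. *)
Lemma glued_lattice_index : has_index (glued_lattice R m) (int_points R m.+3) m.
Proof.
split=> [x xZ|]; first by exists 0; rewrite scale0r subr0.
pose F (t : nat) : set V := [set t%:R *: glue_vector R m + y | y in int_points R m.+3].
have -> : cosets (glued_lattice R m) (int_points R m.+3) = [set F t | t in `I_m].
  apply/seteqP; split=> A /= [x].
    move=> /(glued_lattice_rep m_gt0)[t tm xt] <-; exists t => //.
    apply/seteqP; split=> _ [y yZ <-] /=.
      exists (y - (x - t%:R *: glue_vector R m)); first exact: int_pointsB.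
      by rewrite opprB addrCA [x + _]addrC subrK addrC.
    exists (x - t%:R *: glue_vector R m + y); first exact: int_pointsD.
    by rewrite addrA [_ + (x - _)]addrC subrK.
  move=> tm <-; exists (x%:R *: glue_vector R m) => //.
  exists x%:Z; rewrite subrr; apply/int_pointsP => i; rewrite mxE; exact: rpred0.
apply: inj_card_eq => s t; rewrite !inE /= => sm tm FE.
have : F s (s%:R *: glue_vector R m).
  exists 0; rewrite ?addr0 //; apply/int_pointsP => i; rewrite mxE; exact: rpred0.
rewrite FE => -[y yZ yE].
have : (m %| s%:Z - t%:Z)%Z.
  apply: glue_mul_int; rewrite rmorphB /= scalerBl.
  by rewrite -[X in X - _]yE addrC addKr.
by rewrite -eqz_mod_dvd !modz_nat eqz_nat !modn_small // => /eqP.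
Qed.

(** The rows p, e_2, ..., e_n: since the first coordinate of p is 1 / m, the
    vector e_1 is m p plus an integer combination of the others. *)
Definition glued_basis : 'M[R]_m.+3 :=
  \matrix_(i, j) (if i == ord0 then glue_vector R m 0 j else (i == j)%:R).

Let mul_glued_basis (z : V) j :
  (z *m glued_basis) 0 j = z 0 ord0 * glue_vector R m 0 j + (j != ord0)%:R * z 0 j.
Proof.
rewrite mxE big_ord_recl mxE eqxx; congr (_ + _).
have [->|[k ->]] : j = ord0 \/ exists k, j = lift ord0 k.
- by case: (unliftP ord0 j) => [k|]; [right; exists k|left].
- by rewrite eqxx mul0r big1 // => i _; rewrite mxE /= mulr0.
- rewrite (bigD1 k) //= big1 => [|i ik]; first by rewrite mxE eqxx addr0 mulrC.
  by rewrite mxE /= (inj_eq lift_inj) (negbTE ik) mulr0.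
Qed.

Lemma glued_basis_free : row_free glued_basis.
Proof.
apply: inj_row_free => z zB.
have z0 : z 0 ord0 = 0.
  have : (z *m glued_basis) 0 ord0 = 0 by rewrite zB mxE.
  rewrite mul_glued_basis eqxx mul0r addr0 glue0 => /eqP.
  by rewrite mulf_eq0 invr_eq0 (negbTE m0) orbF => /eqP.
apply/rowP => j; rewrite mxE.
have : (z *m glued_basis) 0 j = 0 by rewrite zB mxE.
rewrite mul_glued_basis z0 mul0r add0r.
by have [->//|_] := eqVneq j ord0; rewrite mul1r.
Qed.

Lemma int_span_glued_basis : int_span glued_basis = glued_lattice R m.
Proof.
apply/seteqP; split=> x.
  case=> z /int_pointsP zZ <-; have /intrP[t zt] := zZ ord0; exists t.
  apply/int_pointsP => j; rewrite !mxE.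
  have -> : \sum_j0 z 0 j0 * glued_basis j0 j = (z *m glued_basis) 0 j by rewrite mxE.
  rewrite mul_glued_basis !mxE zt addrC addKr; by rewrite rpredM ?natr_int.
case=> t /int_pointsP xZ; pose y := x - t%:~R *: glue_vector R m.
have xE j : x 0 j = y 0 j + t%:~R * glue_vector R m 0 j by rewrite !mxE subrK.
(* The first coordinate of x determines the coefficient of p. *)
pose z : V := \row_j (if j == ord0 then m%:R * y 0 ord0 + t%:~R else
  y 0 j - y 0 ord0 * (m%:R * glue_vector R m 0 j)).
exists z.
  apply/int_pointsP => j; rewrite mxE; case: ifP => _.
    by rewrite rpredD ?intr_int // rpredM ?rpred_nat.
  by apply: rpredB => //; apply: rpredM.
apply/rowP => j; rewrite mul_glued_basis xE ![z 0 _]mxE eqxx.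
case: (eqVneq j ord0) => [->|_]; last by rewrite /= mul1r; ring.
by rewrite /= glue0; field.
Qed.

End GluedLatticeIndex.

(** * The two forms of the theorem *)

Lemma posdef_standard_form_mulmx (R : realType) (n : nat) (G : 'M[R]_n) :
  row_free G -> posdef_quadratic_form (fun y => standard_form R n (y *m G)).
Proof.
move=> Gf; split.
  exists (G *m G^T); first by rewrite trmx_mul trmxK.
  move=> x; rewrite mulmxA -mulmxA -trmx_mul mxE.
  by apply: eq_bigr => i _; rewrite [_^T _ _]mxE expr2.
move=> y y0; have : y *m G != 0.
  by apply: contraNneq y0 => yG; apply/eqP/(row_free_inj Gf); rewrite yG mul0mx.
case/rV0Pn => i yi; rewrite /standard_form (bigD1 i) //=.
apply: ltr_wpDr; last by rewrite exprn_even_gt0.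
by apply: sumr_ge0 => j _; exact: sqr_ge0.
Qed.

Theorem theorem3p2 (R : realType) (n : nat) (n_gt3 : (3 < n)%N) :
  (exists2 L : set 'rV[R]_n, point_lattice L &
     delaunay_simplex_of_relative_volume (standard_form R n) L (n - 3)) /\
  (exists2 f : 'rV[R]_n -> R, posdef_quadratic_form f &
     delaunay_simplex_of_relative_volume f (int_points R n) (n - 3)).
Proof.
have [m nE m_gt0] : exists2 m, n = m.+3 & (0 < m)%N by exists (n - 3)%N; lia.
rewrite {}nE {n n_gt3} (_ : (m.+3 - 3)%N = m); last by lia.
have a0 := @glue_weight_gt0 R m m_gt0.
have [H HE] := simplex_form_gram_root a0 (a0 ord_max).
have Hf : row_free H.
  apply: inj_row_free => x xH; apply/eqP; apply: contraT => x0.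
  have := simplex_form_posdef a0 (a0 ord_max) x0; rewrite -HE xH.
  by rewrite /standard_form big1 ?ltxx // => i _; rewrite mxE expr0n.
pose B := glued_basis R m; have Bf : row_free B := glued_basis_free R m_gt0.
have Bu : B \in unitmx by rewrite -row_free_unit.
have BHf : row_free (B *m H) by rewrite row_free_unit unitmx_mul Bu -row_free_unit.
have simplex K f (Kf : row_free K) fK :=
  @delaunay_simplex_of_gauge R _ m _ _ _ K f a0 (a0 ord_max)
    (glued_lattice_index R m_gt0) (simplex_gauge_glued_lattice m_gt0) Kf fK.
rewrite -int_span_glued_basis // in simplex.
have spanE K : [set x *m K | x in int_span B] = int_span (B *m K).
  by rewrite /int_span image_comp; apply: eq_imagel => z _ /=; rewrite mulmxA.
(* The lattice for the standard form takes K = H, the form on Z^n takes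
   K = B^-1. *)
split.
  exists (int_span (B *m H)); first by exists (B *m H).
  by rewrite -spanE; exact: simplex.
exists (fun y => standard_form R m.+3 (y *m (B *m H))).
  exact: posdef_standard_form_mulmx.
have -> : int_points R m.+3 = [set x *m invmx B | x in int_span B].
  rewrite spanE mulmxV // /int_span -[LHS]image_id.
  by apply: eq_imagel => z _; rewrite mulmx1.
apply: simplex => [|x]; first by rewrite row_free_unit unitmx_inv.
by rewrite mulmxA mulmxKV // HE.
Qed.
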